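(* For any integers $m\ge n\ge 2$, $$\min_{\Gamma\in\mathfrak{G}_{m,n}} f_\Gamma=\min_{T\in\mathcal{T}(m,\ell)} m_T,\qquad \ell=m-n+1,$$ where $\mathfrak{G}_{m,n}$ is the set of (isomorphism classes of) strongly connected directed graphs with $m$ arcs and $n$ nodes, and $\mathcal{T}(m,\ell)$ is the set of (isomorphism classes of) rooted trees with $m$ nodes and $\ell$ leaves.
   Context: Graphs are finite and directed; loops and multiple (parallel) arcs are allowed. For a graph $\Gamma$ with arc set $\mathcal{A}(\Gamma)$, $f_\Gamma=\min \sum_{a\in\mathcal{A}(\Gamma)} x_a$, the minimum being over all vectors $(x_a)$ with $x_a\ge 0$ such that $\prod_{a\in\gamma}x_a=1$ for every directed cycle $\gamma$ of $\Gamma$ (a closed directed path not passing through the same node twice; loops are cycles of length one). A rooted tree $T$ with root $\rho$ has arcs directed away from the root; its leaves are the nodes with no outgoing arcs. For a leaf $\lambda$, $\pi(\lambda)$ is the set of nodes on the path from $\rho$ to $\lambda$ (both included). $m_T=\min\sum_{v}y_v$ over all vectors $(y_v)$ of positive node values such that $\prod_{v\in\pi(\lambda)}y_v=1$ for every leaf $\lambda$. *)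

(* Defs.v *)
From HB Require Import structures.
From mathcomp Require Import all_boot all_order all_algebra.
From mathcomp Require Import all_classical all_reals all_analysis.

Set Implicit Arguments.
Unset Strict Implicit.
Unset Printing Implicit Defensive.

Import Order.TTheory GRing.Theory Num.Theory.

Local Open Scope classical_set_scope.
Local Open Scope ring_scope.

Definition is_min (R : realType) (S : set R) (v : R) : Prop :=
  S v /\ lbound S v.

(* Loops ([src a = tgt a]) and parallel arcs are allowed. *)
Record digraph := Digraph {
  dnode : finType;
  darc : finType;
  src : darc -> dnode;
  tgt : darc -> dnode }.

Definition adj (G : digraph) : rel (dnode G) :=
  fun u v => [exists a : darc G, (src a == u) && (tgt a == v)].

Definition strongly_connected (G : digraph) : Prop :=
  forall u v : dnode G, connect (@adj G) u v.

(* A directed cycle is given by its cyclic sequence of arcs, since parallel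
   arcs make the nodes insufficient. The nodes passed through are the sources
   of these arcs; [uniq] is required of them, not just of the arcs. A one-arc
   cycle is a loop. *)
Definition dicycle (G : digraph) (c : seq (darc G)) : bool :=
  [&& c != [::], cycle (fun a b => tgt a == src b) c & uniq (map (@src G) c)].

Definition arc_feasible (R : realType) (G : digraph) (x : darc G -> R) : Prop :=
  (forall a, 0 <= x a) /\
  (forall c : seq (darc G), dicycle c -> \prod_(a <- c) x a = 1).

Definition arc_sums (R : realType) (G : digraph) : set R :=
  [set \sum_(a : darc G) x a | x in [set x : darc G -> R | arc_feasible x]].
Arguments arc_sums R G : clear implicits.

(* [inf] makes this a total function; it is a minimum exactly when
   [is_min (arc_sums R G) (f_graph R G)]. *)
Definition f_graph (R : realType) (G : digraph) : R := inf (arc_sums R G).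

(* Strongly connected, m arcs and n nodes; no quotient by isomorphism is needed,
   as [f_graph] is invariant under isomorphism. A predicate and not a [set],
   because the universe of [digraph] is too large for [set]. *)
Definition in_digraphs (m n : nat) (G : digraph) : Prop :=
  [/\ strongly_connected G, #|darc G| = m & #|dnode G| = n].

(* A rooted tree with arcs directed away from the root: every node is the end
   of exactly one directed walk from the root. Uniqueness is among all walks,
   not only those without repeated nodes: this is what excludes arcs into the
   root and directed cycles. *)
Record rooted_tree := RootedTree {
  tnode : finType;
  tarc : rel tnode;
  troot : tnode;
  tree_axiom : forall v : tnode,
    exists! p : seq tnode, path tarc troot p /\ last troot p = v }.

Definition leaf (T : rooted_tree) : pred (tnode T) :=
  fun v => [forall w, ~~ tarc v w].

(* By [tree_axiom], [troot T :: p] lists the nodes of pi(l), without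
   repetition. *)
Definition node_feasible (R : realType) (T : rooted_tree) (y : tnode T -> R) :
    Prop :=
  (forall v, 0 < y v) /\
  (forall (l : tnode T) (p : seq (tnode T)),
     leaf l -> path (@tarc T) (troot T) p -> last (troot T) p = l ->
     \prod_(v <- troot T :: p) y v = 1).

Definition node_sums (R : realType) (T : rooted_tree) : set R :=
  [set \sum_(v : tnode T) y v | y in [set y : tnode T -> R | node_feasible y]].
Arguments node_sums R T : clear implicits.

Definition m_tree (R : realType) (T : rooted_tree) : R := inf (node_sums R T).

Definition in_rooted_trees (m l : nat) (T : rooted_tree) : Prop :=
  #|tnode T| = m /\ #|@leaf T| = l.

(* Main.v *)
Require Import Defs.
From mathcomp Require Import all_boot all_order all_algebra.
From mathcomp Require Import all_classical all_reals all_analysis.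
From mathcomp Require Import zify.

(** On a strongly connected graph the feasible [x] are exactly the ratios
    [x a = p (tgt a) / p (src a)] for a positive potential [p] on the nodes. A
    rooted tree becomes a graph by turning each node into the arc entering it and
    identifying all leaves with the source of the arc entering the root; so no
    graph minimum exceeds the tree minima. Conversely, given [p] on a graph, let
    [v0] minimize [p] and take a spanning arborescence from [v0]. Redirecting the
    remaining arcs to [v0], and moving all arcs leaving [v0] but one, ending at
    [u], to leave [u], does not increase the sum of the ratios, and yields a graph
    that comes from a tree. *)

Set Implicit Arguments.
Unset Strict Implicit.
Unset Printing Implicit Defensive.

Import Order.TTheory GRing.Theory Num.Theory.
Import numFieldNormedType.Exports.

Local Open Scope classical_set_scope.
Local Open Scope ring_scope.

(** * Attainment of minima under product constraints *)

Section Minima.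
Variable R : realType.

Lemma is_min_inf (S : set R) v : is_min S v -> inf S = v.
Proof.
move=> [Sv lbv]; apply/le_anti/andP; split.
  by apply: ge_inf => //; exists v.
by apply: lb_le_inf => //; exists v.
Qed.

Lemma is_min_inf_le (S : set R) x : is_min S (inf S) -> S x -> inf S <= x.
Proof. by case=> _; apply. Qed.

Lemma is_min_fin_image (I : finType) (P : I -> Prop) (f : I -> R) i0 :
  P i0 -> exists v, is_min [set w | exists2 i, P i & f i = w] v.
Proof.
move=> /asboolP Pi0.
have [i /asboolP Pi min_i] := @arg_minP _ _ _ i0 (fun i => `[< P i >]) f Pi0.
exists (f i); split; first by exists i.
by move=> _ [j /asboolP Pj <-]; exact: min_i.
Qed.

(** Common form of both feasibility conditions. Values are only asked to be nonnegative, which keeps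
    the set closed. *)
Definition unit_products (I : finType) (C : set (seq I)) : set (I -> R) :=
  [set x | (forall i, 0 <= x i) /\
           (forall c, C c -> \prod_(i <- c) x i = 1)].

Lemma closed_unit_products (I : finType) (C : set (seq I)) :
  closed (unit_products C : set (prod_topology (fun _ : I => R))).
Proof.
pose T := prod_topology (fun _ : I => R).
have proj_cont i : continuous (fun x : T => x i).
  exact: (@proj_continuous I (fun=> R) i).
have -> : unit_products C =
    (\bigcap_(i in [set: I]) ((fun x : T => x i) @^-1` [set t | 0 <= t]))
    `&` \bigcap_(c in C)
          ((fun x : T => \prod_(i <- c) x i) @^-1` [set t | t = 1]).
  rewrite eqEsubset; split=> x.
    by move=> [x0 xC]; split=> [i _|c Cc]; [exact: x0|exact: xC].
  by move=> [x0 xC]; split=> [i|c Cc]; [exact: x0|exact: xC].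
apply: closedI; apply: closed_bigI => c _; apply: preimage_closed => // x _.
by apply: continuous_big => //; exact: mul_continuous.
Qed.

(** The all-ones vector is feasible with sum [K], so only vectors of sum at most [K] matter. These
    form a closed subset of the cube with side [[0, K]], which is compact by Tychonoff, and the sum
    is continuous. *)
Lemma unit_products_sum_min (I : finType) (C : set (seq I)) :
  exists v, is_min [set \sum_i x i | x in unit_products C] v.
Proof.
set K := #|I|%:R : R.
pose T := prod_topology (fun _ : I => R).
pose box := [set x : T | forall i, `[0, K]%classic (x i)].
have one_feas : unit_products C (fun=> 1) by split=> // c _; rewrite big1.
have sum_cont : continuous (fun x : T => \sum_i x i).
  apply: continuous_big => //; first exact: add_continuous.
  by move=> i _; exact: (@proj_continuous I (fun=> R) i).
pose F := (unit_products C : set T) `&` [set x : T | \sum_i x i <= K].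
have F1 : F (fun=> 1) by split=> //=; rewrite sumr_const.
have cF : compact F.
  apply: (@subclosed_compact _ _ box).
  - apply: closedI; first exact: closed_unit_products.
    apply: (@preimage_closed _ _ (fun x : T => \sum_i x i) [set t | t <= K]).
      by move=> x _; exact: sum_cont.
    exact: closed_le.
  - apply: (@tychonoff I (fun=> R) (fun=> `[0, K]%classic)) => i.
    exact: segment_compact.
  - move=> x [[x0 _] /= xK] i /=; rewrite in_itv /= x0 /=.
    by apply: le_trans xK; rewrite (bigD1 i) //= lerDl sumr_ge0.
have F0 : F !=set0 by exists (fun=> 1).
have [x /set_mem Fx minx] := compact_EVT_min F0 cF (continuous_subspaceT sum_cont).
exists (\sum_i x i); split; first by exists x => //; case: Fx.
move=> _ [z Cz <-]; have [zK|/ltW Kz] := leP (\sum_i z i) K.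
  by apply: minx; apply/mem_set.
by apply: le_trans Kz; case: Fx.
Qed.

End Minima.

(** * Closed walks and potentials on directed graphs *)

Section Walks.
Variable G : digraph.
Implicit Types (u v w : dnode G) (c : seq (darc G)).

Fixpoint walk u c v : bool :=
  if c is a :: c' then (src a == u) && walk (tgt a) c' v else u == v.

Lemma walk_cat u c1 c2 w :
  walk u (c1 ++ c2) w <-> exists2 v, walk u c1 v & walk v c2 w.
Proof.
elim: c1 u => [|a c1 IHc] u /=.
  by split=> [|[v /eqP ->]] //; exists u.
split=> [/andP[-> /IHc[v c1v c2w]]|[v /andP[-> c1v] c2w]]; first by exists v.
by apply/IHc; exists v.
Qed.

Lemma walk_consE u a c v :
  walk u (a :: c) v =
  [&& src a == u, path (fun a b => tgt a == src b) a c & tgt (last a c) == v].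
Proof.
elim: c a u => [|b c IHc] a u //.
rewrite -[LHS]/((src a == u) && walk (tgt a) (b :: c) v) IHc /=.
by rewrite [src b == _]eq_sym -!andbA.
Qed.

Lemma dicycle_walkP c :
  reflect [/\ c != [::], exists v, walk v c v & uniq (map (@src G) c)]
          (dicycle c).
Proof.
apply: (iffP and3P) => [] []; case: c => [//|a c] _ + uc; rewrite /= rcons_path.
  move=> /andP[pc lc]; split=> //; exists (src a).
  by rewrite -/(walk _ (a :: c) _) walk_consE eqxx pc.
move=> [v]; rewrite -/(walk _ (a :: c) _) walk_consE.
by case/and3P=> [/eqP <- -> ->]; split.
Qed.

Lemma connect_walk u v : connect (@adj G) u v -> exists c, walk u c v.
Proof.
case/connectP=> q; elim: q u => [|w q IHq] u /=.
  by move=> _ ->; exists [::] => /=.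
case/andP=> /existsP[a /andP[/eqP sa /eqP ta]] pq /(IHq _ pq)[c wc].
by exists (a :: c); rewrite /= sa eqxx ta.
Qed.

Lemma not_uniq_map_split (T : Type) (U : eqType) (f : T -> U) (s : seq T) :
  ~~ uniq (map f s) ->
  exists s1 s2 s3 x y, s = s1 ++ (x :: s2) ++ y :: s3 /\ f x = f y.
Proof.
elim: s => [//|x s IHs] /=; rewrite negb_and negbK => /orP[fxs|/IHs].
  suff [s2 [s3 [y [-> fxy]]]] : exists s2 s3 y, s = s2 ++ y :: s3 /\ f x = f y.
    by exists [::], s2, s3, x, y.
  elim: s fxs {IHs} => [//|z s IHs]; rewrite inE => /orP[/eqP fxz|/IHs].
    by exists [::], s, z.
  by move=> [s2 [s3 [y [-> fxy]]]]; exists (z :: s2), s3, y.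
by move=> [s1 [s2 [s3 [y [z [-> fyz]]]]]]; exists (x :: s1), s2, s3, y, z.
Qed.

Section Potential.
Variable R : realType.
Implicit Types (x : darc G -> R) (p : dnode G -> R).

Lemma walk_prod_potential x p u c v :
  (forall a, p (src a) * x a = p (tgt a)) -> walk u c v ->
  p u * \prod_(a <- c) x a = p v.
Proof.
move=> px; elim: c u => [|a c IHc] u /=; first by move/eqP->; rewrite big_nil mulr1.
by case/andP=> /eqP <- /IHc <-; rewrite big_cons mulrA px.
Qed.

(** Ratios of potentials telescope along a walk, so their product around a cycle is 1. *)
Lemma potential_arc_feasible x p :
  (forall v, 0 < p v) -> (forall a, p (src a) * x a = p (tgt a)) ->
  arc_feasible x.
Proof.
move=> p0 px; split=> [a|c /dicycle_walkP[_ [v /(walk_prod_potential px) vc] _]].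
  by rewrite -(pmulr_rge0 _ (p0 (src a))) px ltW.
by apply: (mulfI (lt0r_neq0 (p0 v))); rewrite vc mulr1.
Qed.

(* A closed walk that is not a cycle splits at a repeated node into two shorter
   closed walks. *)
Lemma closed_walk_prod x v c :
  arc_feasible x -> walk v c v -> \prod_(a <- c) x a = 1.
Proof.
move=> [_ xC]; have [n] := ubnP (size c); elim: n c v => // n IHn c v.
rewrite ltnS => cn wc; have [->|c0] := eqVneq c [::]; first by rewrite big_nil.
have [uc|] := boolP (uniq (map (@src G) c)).
  by apply: xC; apply/dicycle_walkP; split=> //; exists v.
move/not_uniq_map_split=> [c1 [c2 [c3 [a [b [ec sab]]]]]].
move: wc cn; rewrite {}ec => /walk_cat[u wc1 /walk_cat[w wc2 wc3]].
have [ua wb] : u = src a /\ w = src b.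
  by case/andP: wc2 => /eqP <- _; case/andP: wc3 => /eqP <-.
rewrite {}ua in wc1 wc2; rewrite {}wb -sab in wc2 wc3.
rewrite !size_cat => cn; rewrite !big_cat /=.
have c13 : \prod_(i <- c1 ++ b :: c3) x i = 1.
  apply: (IHn _ v); last by apply/walk_cat; exists (src a).
  rewrite size_cat; apply: leq_trans cn; rewrite ltn_add2l -[X in (X < _)%N]add0n.
  by rewrite ltn_add2r.
rewrite (IHn (a :: c2) (src a)) ?mul1r -?big_cat //.
apply: leq_trans cn.
by rewrite addnCA -[X in (X < _)%N]addn0 ltn_add2l addn_gt0 orbC.
Qed.

Hypothesis sG : strongly_connected G.

(** By strong connectivity the arc lies on a closed walk; the product there is 1, so no factor
    vanishes. *)
Lemma feasible_gt0 x a : arc_feasible x -> 0 < x a.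
Proof.
move=> xf; rewrite lt0r; case: (xf) => -> _; rewrite andbT.
have [c wc] := connect_walk (sG (tgt a) (src a)).
have wac : walk (src a) (a :: c) (src a) by rewrite /= eqxx.
apply: contra_eq_neq (closed_walk_prod xf wac) => xa0.
by rewrite big_cons xa0 mul0r eq_sym oner_neq0.
Qed.

(** The potential of [v] is the product of [x] along a chosen walk from a base node [r] to [v]. The
    choice is immaterial: two walks with the same end, completed by the same walk back to [r], both
    have product 1. *)
Lemma feasible_potential x :
  arc_feasible x ->
  exists2 p : dnode G -> R, forall v, 0 < p v &
    forall a, p (src a) * x a = p (tgt a).
Proof.
move=> xf; have x0 a := feasible_gt0 a xf.
have prod0 c : 0 < \prod_(a <- c) x a by apply: prodr_gt0.
have [[r _]|nr] := pselect (exists v : dnode G, True); last first.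
  by exists (fun=> 1) => [//|a]; case: nr; exists (src a).
have /choice[W wW] : forall v, exists c, walk r c v.
  by move=> v; exact/connect_walk.
exists (fun v => \prod_(a <- W v) x a) => [//|a].
(* After multiplication by the product over [Z], both sides become products over closed walks at
   [r]: one goes to [src a], along [a] and back by [Z], the other to [tgt a] and back by [Z]. *)
have [Z wZ] := connect_walk (sG (tgt a) r).
apply: (mulIf (lt0r_neq0 (prod0 Z))).
rewrite -mulrA -[x a * _](big_cons _ _ a Z predT) -!big_cat.
rewrite !(@closed_walk_prod x r) //; apply/walk_cat.
  by exists (tgt a).
by exists (src a) => //=; rewrite eqxx.
Qed.

End Potential.
End Walks.

Lemma graph_min (R : realType) (G : digraph) :
  is_min (arc_sums R G) (f_graph R G).
Proof.
have [v minv] := unit_products_sum_min R [set c : seq (darc G) | dicycle c].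
by rewrite /f_graph (is_min_inf minv).
Qed.

(** * Rooted trees and the graph made from a tree *)

Section RootedTrees.
Variable T : rooted_tree.
Local Notation root := (troot T).
Local Notation arc := (@tarc T).
Implicit Types u v w : tnode T.

Definition root_path v : seq (tnode T) := projT1 (cid (tree_axiom v)).

Lemma root_pathP v : path arc root (root_path v).
Proof. by rewrite /root_path; case: cid => p [[]]. Qed.

Lemma last_root_path v : last root (root_path v) = v.
Proof. by rewrite /root_path; case: cid => p [[]]. Qed.

Lemma root_path_unique p : path arc root p -> p = root_path (last root p).
Proof.
by move=> rp; rewrite /root_path; case: cid => q [_ uq] /=; symmetry; apply: uq.
Qed.

Lemma root_path_root : root_path root = [::].
Proof. by symmetry; apply: (@root_path_unique [::]). Qed.

Lemma root_path_rcons u v : arc u v -> root_path v = rcons (root_path u) v.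
Proof.
move=> uv; rewrite [RHS]root_path_unique ?last_rcons //.
by rewrite rcons_path root_pathP last_root_path.
Qed.

Lemma no_arc_to_root u : arc u root = false.
Proof.
apply/negP => /root_path_rcons; rewrite root_path_root => /(congr1 size).
by rewrite size_rcons.
Qed.

Lemma parent_unique u u' v : arc u v -> arc u' v -> u = u'.
Proof.
move=> /root_path_rcons + /root_path_rcons => -> /rcons_inj [/(congr1 (last root))].
by rewrite !last_root_path.
Qed.

Lemma parent_exists v : v != root -> exists u, arc u v.
Proof.
have := last_root_path v; have := root_pathP v.
case/lastP: (root_path v) => [|q w]; first by move=> _ /= ->; rewrite eqxx.
by rewrite rcons_path last_rcons => /andP[_ aw] <- _; exists (last root q).
Qed.

(** A descendant of [v] at maximal depth is a leaf, since a child would be deeper. *)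
Lemma leaf_below v : exists2 l, leaf l & connect arc v l.
Proof.
have [l vl maxl] := arg_maxnP (fun w => size (root_path w)) (connect0 arc v).
exists l => //; apply/forallP => w; apply/negP => lw.
have := maxl w (connect_trans vl (connect1 lw)).
by rewrite (root_path_rcons lw) size_rcons /= ltnn.
Qed.

Section Feasible.
Variable R : realType.
Implicit Types y : tnode T -> R.

(** Strict positivity comes for free: every node lies on a path from the root to a leaf, whose
    product 1 excludes a zero factor. Hence the compactness argument applies to trees too. *)
Lemma node_feasible_unit_products y :
  node_feasible y <->
  unit_products [set c | exists p l, [/\ leaf l, path arc root p, last root p = l
                                     & c = root :: p]] y.
Proof.
split=> [[y0 yl]|[y0 yl]].
  by split=> [v|_ [p [l [? ? ? ->]]]]; [exact/ltW/y0|apply: (yl l)].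
split=> [v|l p ll rp lp]; last by apply: yl; exists p, l.
rewrite lt0r y0 andbT; have [l ll /connectP[q vq lq]] := leaf_below v.
have yq : \prod_(w <- root :: (root_path v ++ q)) y w = 1.
  apply: yl; exists (root_path v ++ q), l; split=> //.
    by rewrite cat_path root_pathP last_root_path.
  by rewrite last_cat last_root_path.
have : v \in root :: (root_path v ++ q).
  by rewrite -cat_cons mem_cat -{1}[v]last_root_path mem_last.
move=> vin; apply: contra_eq_neq yq => yv0.
by rewrite (big_rem v) //= yv0 mul0r eq_sym oner_neq0.
Qed.

Lemma tree_min : is_min (node_sums R T) (m_tree R T).
Proof.
set C := [set c | exists p l, [/\ leaf l, path arc root p, last root p = l
                              & c = root :: p]].
have -> : m_tree R T = inf [set \sum_v y v | y in unit_products C].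
  congr inf; rewrite eqEsubset.
  by split=> w [y /node_feasible_unit_products yf <-]; exists y.
have -> : node_sums R T = [set \sum_v y v | y in unit_products C].
  rewrite eqEsubset.
  by split=> w [y /node_feasible_unit_products yf <-]; exists y.
have [v minv] := unit_products_sum_min R C.
by rewrite (is_min_inf minv).
Qed.

End Feasible.

(* Every node of [T] becomes the arc entering it; the leaves, together with the
   source of the arc entering the root, are identified to the node [None]. *)
Definition leaf_quotient v : option {w | ~~ leaf w} := insub v.

Definition tree_graph : digraph :=
  @Digraph (option {w | ~~ leaf w}) (tnode T)
    (fun v => if [pick u | arc u v] is Some u then leaf_quotient u else None)
    leaf_quotient.

Lemma src_tree_graph u v : arc u v -> @src tree_graph v = leaf_quotient u.
Proof.
move=> uv /=; case: pickP => [w wv|/(_ u)]; last by rewrite uv.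
by rewrite (parent_unique uv wv).
Qed.

Lemma src_tree_graph_root : @src tree_graph root = None.
Proof. by rewrite /=; case: pickP => [w|//]; rewrite no_arc_to_root. Qed.

Lemma leaf_quotient_leaf v : leaf v -> leaf_quotient v = None.
Proof. by move=> lv; rewrite /leaf_quotient insubN ?negbK. Qed.

Lemma connect_tree_graph u v : connect arc u v ->
  connect (@adj tree_graph) (leaf_quotient u) (leaf_quotient v).
Proof.
case/connectP=> q; elim: q u => [|w q IHq] u /=.
  by move=> _ ->; exact: connect0.
case/andP=> uw wq /(IHq _ wq); apply: connect_trans; apply: connect1.
by apply/existsP; exists w; rewrite (src_tree_graph uw) !eqxx.
Qed.

(** Everything passes through [None]: each node reaches it by descending to a leaf, and it reaches
    each node through the arc [root]. *)
Lemma tree_graph_strongly_connected : strongly_connected tree_graph.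
Proof.
have lqE (s : {w | ~~ leaf w}) : Some s = leaf_quotient (val s).
  by rewrite /leaf_quotient valK.
have to_None o : connect (@adj tree_graph) o None.
  case: o => [s|]; last exact: connect0.
  have [l ll /connect_tree_graph] := leaf_below (val s).
  by rewrite -lqE (leaf_quotient_leaf ll).
have of_None o : connect (@adj tree_graph) None o.
  case: o => [s|]; last exact: connect0.
  apply: (@connect_trans _ _ (leaf_quotient root)).
    apply: connect1; apply/existsP; exists root.
    by rewrite src_tree_graph_root !eqxx.
  rewrite lqE; apply: connect_tree_graph.
  apply/connectP; exists (root_path (val s)); first exact: root_pathP.
  by rewrite last_root_path.
by move=> u v; exact: connect_trans (to_None u) (of_None v).
Qed.

Lemma tree_graph_card m n : (0 < n <= m)%N ->
  in_rooted_trees m (m - n + 1) T -> in_digraphs m n tree_graph.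
Proof.
move=> /andP[n0 nm] [mT lT]; split=> //; first exact: tree_graph_strongly_connected.
(* The tree has [n - 1] nodes that are not leaves; [None] is the remaining node of the graph. *)
rewrite /= card_option card_sig.
have : (#|@leaf T| + #|[pred w : tnode T | ~~ leaf w]| = m)%N.
  by rewrite -mT -(cardC (@leaf T)); congr addn; apply: eq_card.
by rewrite lT; lia.
Qed.

(** The product of [y] over the path from the root is a potential. It is 1 at every leaf, so it is
    well defined on the quotient, with value 1 at [None]. *)
Lemma tree_graph_feasible (R : realType) (y : tnode T -> R) :
  node_feasible y -> @arc_feasible R tree_graph y.
Proof.
move=> [y0 yl]; pose P v := \prod_(w <- root :: root_path v) y w.
pose p (o : dnode tree_graph) := if o is Some s then P (val s) else 1.
have P0 v : 0 < P v by apply: prodr_gt0.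
have pP v : p (leaf_quotient v) = P v.
  rewrite /leaf_quotient; case: insubP => [s _ <- //|/negbNE lv] /=.
  by rewrite /P (yl v) //; [exact: root_pathP|exact: last_root_path].
apply: (@potential_arc_feasible tree_graph R y p).
  by case=> [s|] //=; exact: ltr01.
move=> v; rewrite -[@tgt tree_graph v]/(leaf_quotient v) pP.
have [->|/parent_exists[u uv]] := eqVneq v root.
  by rewrite src_tree_graph_root /P root_path_root big_seq1 mul1r.
by rewrite (src_tree_graph uv) pP /P (root_path_rcons uv) -rcons_cons big_rcons.
Qed.

End RootedTrees.

(** * Rooted trees from parent functions *)

Section ParentTree.
Variables (N : finType) (r : N) (par : N -> N) (rank : N -> nat).
Hypothesis rank_par : forall v, v != r -> (rank (par v) < rank v)%N.

Definition parent_arc : rel N := fun u v => (v != r) && (par v == u).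

(** The decreasing rank makes the climb from [v] through its parents end at [r]. Uniqueness holds
    because the end of a path determines the node before it, and no arc enters [r]. *)
Lemma parent_tree_axiom (v : N) :
  exists! p, path parent_arc r p /\ last r p = v.
Proof.
have [p [rp lp]] : exists p, path parent_arc r p /\ last r p = v.
  have [n] := ubnP (rank v); elim: n v => // n IHn v; rewrite ltnS => vn.
  have [->|vr] := eqVneq v r; first by exists [::].
  have [p [rp lp]] := IHn _ (leq_trans (rank_par vr) vn).
  exists (rcons p v); rewrite last_rcons; split=> //.
  by rewrite rcons_path rp lp /parent_arc vr eqxx.
exists p; split=> // q []; rewrite -{}lp.
elim/last_ind: p q rp => [|p w IHp] q; case/lastP: q => [|q z] //=.
- by rewrite rcons_path last_rcons => _ /andP[_ /andP[+ _]] zr; rewrite zr eqxx.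
- by rewrite rcons_path last_rcons => /andP[_ /andP[+ _]] _ wr; rewrite -wr eqxx.
rewrite !rcons_path !last_rcons => /andP[rp /andP[_ /eqP pw]].
move=> /andP[rq /andP[_ /eqP pz]] zw.
by rewrite zw (IHp q) // -pw -pz zw.
Qed.

Definition parent_tree : rooted_tree := RootedTree parent_tree_axiom.

End ParentTree.

(** * From a graph with a potential to a tree *)

Lemma spanning_arborescence (G : digraph) (v0 : dnode G) (a0 : darc G) :
  strongly_connected G ->
  exists (parc : dnode G -> darc G) (d : dnode G -> nat), forall v, v != v0 ->
    tgt (parc v) = v /\ (d (src (parc v)) < d v)%N.
Proof.
move=> sG.
(* [d v] is the distance from [v0]; [parc v] will be the last arc of a shortest walk to [v]. *)
have /choice[d dP] : forall v, exists k : nat,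
    (exists2 c, walk v0 c v & size c = k) /\
    (forall c, walk v0 c v -> (k <= size c)%N).
  move=> v; have [c wc] := connect_walk (sG v0 v).
  have ex : exists k, `[< exists2 c, walk v0 c v & size c = k >].
    by exists (size c); apply/asboolP; exists c.
  case: (ex_minnP ex) => k /asboolP kP mink; exists k; split=> // c' wc'.
  by apply: mink; apply/asboolP; exists c'.
have /choice[parc parcP] : forall v, exists a : darc G, v != v0 ->
    tgt a = v /\ (d (src a) < d v)%N.
  (* [a0] is only a default value at [v0]. *)
  move=> v; have [->|vv0] := eqVneq v v0; first by exists a0.
  have [[c wc sc] _] := dP v; case/lastP: c wc sc => [|c a].
    by move=> /= /eqP e; rewrite e eqxx in vv0.
  rewrite -cats1 => /walk_cat[w wc /andP[/eqP saw /eqP tav]].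
  rewrite cats1 size_rcons => dv; exists a => _; split=> //.
  by rewrite saw -dv ltnS; case: (dP w) => _; exact.
by exists parc, d.
Qed.

Section GraphToTree.
Variables (R : realType) (G : digraph) (p : dnode G -> R).
Hypothesis sG : strongly_connected G.
Hypothesis p0 : forall v, 0 < p v.
Variables (v0 u : dnode G) (parc : dnode G -> darc G) (d : dnode G -> nat).
Hypothesis p_v0 : forall v, p v0 <= p v.
Hypothesis parcP :
  forall v, v != v0 -> tgt (parc v) = v /\ (d (src (parc v)) < d v)%N.
Hypothesis u_v0 : u != v0.
Hypothesis src_u : src (parc u) = v0.

Definition in_arborescence (a : darc G) := (tgt a != v0) && (parc (tgt a) == a).

(* Arcs outside the arborescence are redirected to the lowest node [v0], and all
   arcs leaving [v0] but [parc u] are moved to leave the higher node [u]; neither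
   move increases the ratio of potentials. *)
Definition cut_tgt a := if in_arborescence a then tgt a else v0.
Definition cut_src a := if (src a == v0) && (a != parc u) then u else src a.
Definition cut_ratio a := p (cut_tgt a) / p (cut_src a).
(** The arcs of [G] become the tree nodes, with [parc u] as root; the parent of any other arc is the
    arborescence arc entering its new source. *)
Definition cut_parent a := parc (cut_src a).
(** The distance [d] alone does not decrease for the arcs moved from [v0] to [u]. The root gets rank
    0 and the arcs now leaving [u] rank 1; the shift by 2 places all others above them. *)
Definition cut_rank a :=
  if a == parc u then 0%N else if cut_src a == u then 1%N else (d (cut_src a)).+2.

Lemma cut_src_neq a : a != parc u -> cut_src a != v0.
Proof. by move=> ar; rewrite /cut_src ar andbT; case: ifPn. Qed.

Lemma cut_rank_lt a : a != parc u -> (cut_rank (cut_parent a) < cut_rank a)%N.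
Proof.
move=> ar; rewrite [X in (_ < X)%N]/cut_rank (negPf ar) /cut_parent.
have [->|au] := eqVneq (cut_src a) u; first by rewrite /cut_rank eqxx.
have [_] := parcP (cut_src_neq ar); move: (parc (cut_src a)) => b lt_d.
rewrite /cut_rank; case: ifP => // _; case: ifPn => // bu; rewrite !ltnS.
(* A moved arc would have new source [u], a case already excluded. *)
suff -> : cut_src b = src b by [].
by move: bu; rewrite /cut_src; case: ifP => // _; rewrite eqxx.
Qed.

Definition cut_tree := parent_tree cut_rank_lt.

Lemma cut_parent_arc a :
  a != parc u ->
  in_arborescence (cut_parent a) /\
  cut_tgt (cut_parent a) = cut_src a.
Proof.
move=> /cut_src_neq a0; have [ta _] := parcP a0.
have tp : in_arborescence (cut_parent a).
  by rewrite /in_arborescence /cut_parent ta a0 eqxx.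
by rewrite /cut_tgt tp.
Qed.

Lemma cut_src_root : cut_src (parc u) = v0.
Proof. by rewrite /cut_src eqxx andbF. Qed.

(** The head of an arborescence arc differs from [v0], so by strong connectivity some arc leaves it;
    that arc was not moved, is not the root, and is a child. Conversely every parent is an
    arborescence arc. *)
Lemma leaf_cut_tree a : @leaf cut_tree a = ~~ in_arborescence a.
Proof.
apply/forallP/idP => [la|ta b].
  apply/negP => /andP[av0 /eqP pa].
  have [c wc] := connect_walk (sG (tgt a) v0).
  case: c wc => [/= /eqP e|b c /= /andP[/eqP sb _]].
    by rewrite e eqxx in av0.
  have := la b.
  rewrite /= /parent_arc /cut_parent /cut_src sb (negPf av0) /= pa eqxx andbT.
  by rewrite negbK => /eqP br; move: av0; rewrite -sb br src_u eqxx.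
apply: contra ta => /= /andP[br /eqP <-].
by have [] := cut_parent_arc br.
Qed.

(** [parc] maps the nodes other than [v0] bijectively to the arborescence arcs, with inverse
    [tgt]. *)
Lemma card_in_arborescence : #|in_arborescence| = #|dnode G|.-1.
Proof.
rewrite (cardD1 v0) /= -(card_in_imset (f := parc)) => [|v w].
  apply: eq_card => a; apply/idP/imsetP => [/andP[av0 /eqP pa]|[v]].
    by exists (tgt a); rewrite ?inE ?av0.
  rewrite !inE andbT => vv0 ->; have [tv _] := parcP vv0.
  by rewrite /in_mem /= /in_arborescence tv vv0 eqxx.
rewrite !inE !andbT => /parcP[tv _] /parcP[tw _] e.
by rewrite -tv -tw e.
Qed.

Lemma cut_tree_in_rooted_trees : (#|dnode G| <= #|darc G|)%N ->
  in_rooted_trees #|darc G| (#|darc G| - #|dnode G| + 1) cut_tree.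
Proof.
move=> nm; split=> //; have : (#|@leaf cut_tree| + #|in_arborescence| = #|darc G|)%N.
  rewrite -(cardC in_arborescence) addnC; congr addn.
  by apply: eq_card => a; rewrite -[LHS]/(@leaf cut_tree a) leaf_cut_tree.
have : (0 < #|dnode G|)%N by apply/card_gt0P; exists v0.
rewrite card_in_arborescence; lia.
Qed.

Lemma path_cut_ratio_prod a q :
  path (parent_arc (parc u) cut_parent) a q ->
  \prod_(b <- a :: q) cut_ratio b = p (cut_tgt (last a q)) / p (cut_src a).
Proof.
elim: q a => [|b q IHq] a /=; first by rewrite big_seq1.
case/andP=> /andP[br /eqP pb] bq; rewrite big_cons IHq // /cut_ratio.
have [_] := cut_parent_arc br; rewrite pb => ->.
by rewrite mulrC mulrA divfK // lt0r_neq0.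
Qed.

(** The product along a path telescopes. The root has source [v0] and a leaf has new target [v0], so
    the potentials at the two ends cancel. *)
Lemma cut_ratio_feasible : @node_feasible R cut_tree cut_ratio.
Proof.
split=> [a|l q ll rq lq]; first exact: divr_gt0.
rewrite path_cut_ratio_prod // -/(troot cut_tree) lq /cut_tgt.
rewrite -[in_arborescence l]negbK -leaf_cut_tree ll /=.
by rewrite cut_src_root divff // lt0r_neq0.
Qed.

Lemma cut_ratio_le a : cut_ratio a <= p (tgt a) / p (src a).
Proof.
apply: ler_pM; rewrite ?invr_ge0 ?(ltW (p0 _)) //.
  by rewrite /cut_tgt; case: ifP.
by rewrite lef_pV2 ?posrE // /cut_src; case: ifP => // /andP[/eqP ->].
Qed.

End GraphToTree.

Lemma graph_to_tree (R : realType) (G : digraph) (p : dnode G -> R) :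
  strongly_connected G -> (1 < #|dnode G| <= #|darc G|)%N -> (forall v, 0 < p v) ->
  exists (T : rooted_tree) (y : tnode T -> R),
    [/\ in_rooted_trees #|darc G| (#|darc G| - #|dnode G| + 1) T,
        node_feasible y & \sum_v y v <= \sum_a p (tgt a) / p (src a)].
Proof.
move=> sG /andP[/card_gt1P[v1 [v2 [_ _ v12]]] nm] p0.
have [v0 _ v0min] := @arg_minP _ _ _ v1 predT p isT.
have [w wv0] : exists w, w != v0.
  by have [e|] := eqVneq v1 v0; [exists v2; rewrite -e eq_sym|exists v1].
have [a0 _] : exists a0 : darc G, True.
  have [[|a c] /=] := connect_walk (sG w v0); first by rewrite (negPf wv0).
  by exists a.
have [parc [d parcP]] := spanning_arborescence v0 a0 sG.
(* Minimality of [d u] among the nodes other than [v0] forces the arc [parc u] to leave [v0]. *)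
have [u uv0 umin] := @arg_minnP _ w (predC1 v0) d wv0.
have src_u : src (parc u) = v0.
  apply/eqP/negPn/negP => /umin; rewrite leqNgt.
  by have [_ ->] := parcP u uv0.
have v0P v : p v0 <= p v by exact: v0min.
exists (cut_tree parcP uv0), (cut_ratio p v0 u parc); split.
- exact: (cut_tree_in_rooted_trees sG parcP uv0 src_u nm).
- exact: (cut_ratio_feasible sG p0 parcP uv0 src_u).
- by apply: ler_sum => a _; exact: (cut_ratio_le p0 u parc v0P).
Qed.

(** * Reduction to finitely many graphs by relabelling *)

Section Relabelling.
Variables (R : realType) (G G' : digraph).
Variables (e : darc G -> darc G') (e' : darc G' -> darc G).
Variables (h : dnode G -> dnode G').
Hypotheses (eK : cancel e e') (e'K : cancel e' e) (h_inj : injective h).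
Hypothesis src_e : forall a, src (e a) = h (src a).
Hypothesis tgt_e : forall a, tgt (e a) = h (tgt a).

Lemma dicycle_map c : dicycle (map e c) = dicycle c.
Proof.
rewrite /dicycle; congr [&& _, _ & _].
- by case: c.
- rewrite cycle_map; apply: eq_cycle => a b /=.
  by rewrite tgt_e src_e (inj_eq h_inj).
- by rewrite -(map_inj_uniq h_inj) -!map_comp; congr uniq; apply: eq_map => a /=.
Qed.

Lemma arc_sums_relabel : arc_sums R G = arc_sums R G'.
Proof.
rewrite eqEsubset; split=> w [x [x0 xC] <-].
  exists (x \o e').
    split=> [a|c cc] /=; first exact: x0.
    rewrite -(big_map e' predT x); apply: xC; rewrite -dicycle_map -map_comp.
    by rewrite (eq_map (g := id)) ?map_id.
  by rewrite (reindex e) /=; [apply: eq_bigr => a _; rewrite eK|exists e' => a _].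
exists (x \o e).
  split=> [a|c cc] /=; first exact: x0.
  by rewrite -(big_map e predT x); apply: xC; rewrite dicycle_map.
by rewrite [RHS](reindex e) //; exists e' => a _.
Qed.

End Relabelling.

(** The pairs [st] form a finite type, so a minimum over these graphs exists; every graph with [m]
    arcs and [n] nodes is isomorphic to one of them. *)
Definition ord_digraph m n (st : {ffun 'I_m -> 'I_n} * {ffun 'I_m -> 'I_n}) :=
  @Digraph 'I_n 'I_m st.1 st.2.

Lemma ord_digraph_f_graph (R : realType) m n (G : digraph) :
  in_digraphs m n G ->
  exists2 st : {ffun 'I_m -> 'I_n} * {ffun 'I_m -> 'I_n},
    in_digraphs m n (ord_digraph st) & f_graph R (ord_digraph st) = f_graph R G.
Proof.
move=> [sG eqm eqn]; subst m n.
pose st := ([ffun a => enum_rank (src (enum_val a : darc G))],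
            [ffun a => enum_rank (tgt (enum_val a : darc G))]) :
  {ffun 'I_#|darc G| -> 'I_#|dnode G|} * {ffun 'I_#|darc G| -> 'I_#|dnode G|}.
have src_e (a : darc G) : @src (ord_digraph st) (enum_rank a) = enum_rank (src a).
  by rewrite /= ffunE enum_rankK.
have tgt_e (a : darc G) : @tgt (ord_digraph st) (enum_rank a) = enum_rank (tgt a).
  by rewrite /= ffunE enum_rankK.
exists st; last first.
  congr inf; symmetry.
  exact: (@arc_sums_relabel R G (ord_digraph st) enum_rank enum_val enum_rank
    (@enum_rankK _) (@enum_valK _) (@enum_rank_inj _) src_e tgt_e).
split; rewrite ?card_ord // => v w.
have -> : v = enum_rank (enum_val v) by rewrite enum_valK.
have -> : w = enum_rank (enum_val w) by rewrite enum_valK.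
move: (enum_val v) (enum_val w) => {}v {}w.
have /connectP[q] := sG v w; elim: q v => [|z q IHq] v /=; first by move=> _ ->.
case/andP=> /existsP[a /andP[/eqP sa /eqP ta]] zq /(IHq _ zq).
apply: connect_trans; apply: connect1; apply/existsP; exists (enum_rank a).
by rewrite src_e tgt_e sa ta !eqxx.
Qed.

(** * Existence of a tree, and equality of the two minima *)

Lemma rooted_trees_nonempty m n : (2 <= n <= m)%N ->
  exists T, in_rooted_trees m (m - n + 1) T.
Proof.
case: m => [|m]; first by case: n => [|[]].
move=> /andP[n2 nm].
(* A path with [n - 1] nodes whose last node carries all the leaves. *)
pose par (i : 'I_m.+1) : 'I_m.+1 := inord (minn i.-1 (n - 2)).
have parE i : par i = minn i.-1 (n - 2) :> nat.
  by rewrite inordK //; have := ltn_ord i; lia.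
have rank_par (i : 'I_m.+1) : i != ord0 -> (par i < i)%N.
  by move=> i0; rewrite parE; have : i != 0%N :> nat by []; lia.
exists (parent_tree rank_par); split; first by rewrite /= card_ord.
have leafE (i : 'I_m.+1) : @leaf (parent_tree rank_par) i = (n.-1 <= i)%N.
  apply/forallP/idP => [li|ni j].
    rewrite leqNgt; apply/negP => ni.
    have im : (i.+1 < m.+1)%N by lia.
    have /negP := li (Ordinal im); apply; rewrite /= /parent_arc /=.
    by apply/eqP/val_inj; rewrite /= parE /=; lia.
  apply/negP => /andP[_ /eqP/(congr1 val)/=]; rewrite parE; lia.
have : (#|@leaf (parent_tree rank_par)| +
        #|[pred i : 'I_m.+1 | (i < n.-1)%N]| = m.+1)%N.
  rewrite -[RHS]card_ord -(cardC (@leaf (parent_tree rank_par))); congr addn.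
  apply: eq_card => i; rewrite !inE -[i \in _]/(@leaf (parent_tree rank_par) i).
  by rewrite leafE ltnNge.
suff -> : #|[pred i : 'I_m.+1 | (i < n.-1)%N]| = n.-1 by lia.
rewrite -sum1_card -[RHS]card_ord -[RHS]sum1_card.
by rewrite (big_ord_widen m.+1 (fun=> 1%N)) //; lia.
Qed.

(* The first two conjuncts say that every f_Gamma and m_T involved is an
   attained minimum; the third, that both outer minima exist and are equal. *)
Theorem mainTheorem5 (R : realType) (m n : nat) (hn : (2 <= n)%N)
    (hmn : (n <= m)%N) :
  [/\ forall G : digraph, in_digraphs m n G ->
        is_min (arc_sums R G) (f_graph R G),
      forall T : rooted_tree, in_rooted_trees m (m - n + 1)%N T ->
        is_min (node_sums R T) (m_tree R T)
    & exists v : R,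
        is_min [set w | exists2 G : digraph, in_digraphs m n G &
                          f_graph R G = w] v /\
        is_min [set w | exists2 T : rooted_tree,
                          in_rooted_trees m (m - n + 1)%N T &
                          m_tree R T = w] v].
Proof.
have n_m : (0 < n <= m)%N by rewrite hmn andbT; lia.
have f_le_m T : in_rooted_trees m (m - n + 1) T ->
    exists2 G, in_digraphs m n G & f_graph R G <= m_tree R T.
  move=> TT; exists (tree_graph T); first exact: tree_graph_card.
  have [[y yf <-] _] := tree_min T R.
  apply: is_min_inf_le; first exact: graph_min.
  by exists y => //; exact: tree_graph_feasible.
have m_le_f G : in_digraphs m n G ->
    exists2 T, in_rooted_trees m (m - n + 1) T & m_tree R T <= f_graph R G.
  move=> [sG mG nG]; have [[x xf <-] _] := graph_min R G.
  have [p p0 px] := feasible_potential sG xf.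
  have [|T [y [TT yf le_yx]]] := graph_to_tree sG _ p0; first by rewrite nG mG hn.
  exists T; first by rewrite -mG -nG.
  apply: (@le_trans _ _ (\sum_v y v)).
    by apply: is_min_inf_le; [exact: tree_min|exists y].
  apply: le_trans le_yx _; apply: ler_sum => a _.
  (* The ratio of potentials along [a] is [x a] itself. *)
  by rewrite -px mulrAC divff ?mul1r // lt0r_neq0.
split=> [G _|T _|]; [exact: graph_min|exact: tree_min|].
(* A tree also provides a graph, so the finite family to be minimized over is not empty. *)
have [T0 /f_le_m[G0 G0mn _]] : exists T, in_rooted_trees m (m - n + 1) T.
  by apply: rooted_trees_nonempty; rewrite hn.
have [st0 st0mn _] := ord_digraph_f_graph R G0mn.
have [v [[st stmn stv] minv]] := is_min_fin_image
  (P := fun st => in_digraphs m n (ord_digraph st))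
  (fun st => f_graph R (ord_digraph st)) st0mn.
have v_le G : in_digraphs m n G -> v <= f_graph R G.
  by move=> /(ord_digraph_f_graph R)[st' st'mn <-]; apply: minv; exists st'.
have v_le_m T : in_rooted_trees m (m - n + 1) T -> v <= m_tree R T.
  by move=> /f_le_m[G Gmn]; apply: le_trans; exact: v_le.
exists v; split; split; first by exists (ord_digraph st).
- by move=> _ [G Gmn <-]; exact: v_le.
(* The tree obtained from an optimal graph has minimum at most [v], and no tree goes below [v]. *)
- have [T TT leT] := m_le_f _ stmn; exists T => //.
  by apply/le_anti; rewrite v_le_m // -stv leT.
- by move=> _ [T TT <-]; exact: v_le_m.
Qed.
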